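(* For every $g \geq 2$, the linearization map $\Phi\colon \mathfrak{Z}_g^s \rightarrow \operatorname{Sym}^2(H)$, defined on generators by $\Phi(\langle v_1,v_2\rangle_s) = v_1 \cdot v_2$, is an isomorphism of $\mathbb{Q}$-vector spaces.
   Context: $H = \mathbb{Q}^{2g}$ and $H_{\mathbb{Z}} = \mathbb{Z}^{2g} \subset H$, and $\omega\colon H \times H \to \mathbb{Q}$ is the standard symplectic form (integral and unimodular on $H_{\mathbb{Z}}$). Vectors $v_1,v_2$ are orthogonal if $\omega(v_1,v_2)=0$. For $v \in H_{\mathbb{Z}}$, $v^{\perp}_{\mathbb{Z}} = \{w \in H_{\mathbb{Z}} : \omega(v,w)=0\}$. A set of vectors in a finitely generated free abelian group is a partial basis if it can be extended to a basis; a vector $v$ is primitive if $\{v\}$ is a partial basis. The product in the symmetric algebra is written $x \cdot y$. $\mathfrak{Z}_g^s$ is the $\mathbb{Q}$-vector space with the following presentation. Generators: a formal symbol $\langle v_1,v_2\rangle_s$ for all orthogonal primitive vectors $v_1,v_2 \in H_{\mathbb{Z}}$. Relations: (1) for all generators $\langle v_1,v_2\rangle_s$, the relation $\langle v_2,v_1\rangle_s = \langle v_1,v_2\rangle_s$; (2) for all primitive $v \in H_{\mathbb{Z}}$ and all partial bases $\{w_1,w_2\}$ of $v^{\perp}_{\mathbb{Z}}$, the relation $\langle v,w_1+w_2\rangle_s = \langle v,w_1\rangle_s+\langle v,w_2\rangle_s$. The formula $\Phi(\langle v_1,v_2\rangle_s) = v_1\cdot v_2$ takes relations to relations, so it gives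 a well-defined linear map. *)

(* Defs.v *)
From HB Require Import structures.
From mathcomp Require Import all_boot all_order all_algebra.
From mathcomp Require Import generic_quotient ring_quotient.
From mathcomp Require Import finmap boolp.
From mathcomp Require Import monalg.

Set Implicit Arguments.
Unset Strict Implicit.
Unset Printing Implicit Defensive.

Import GRing.Theory.
Local Open Scope ring_scope.
Local Open Scope quotient_scope.

(* Locked: unification of unequal monomials << k >> is prohibitively slow. *)
HB.lock Definition fgen (K : choiceType) (k : K) : {malg rat[K]} := << k >>.

Section Presented.
Variables (K : choiceType) (rel : {malg rat[K]} -> Prop).

Definition relspan : {pred {malg rat[K]}} := fun x => `[<
  exists s : seq (rat * {malg rat[K]}),
    (forall p, p \in s -> rel p.2) /\ x = \sum_(p <- s) p.1 *: p.2 >].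

Fact relspan_submod : submod_closed relspan.
Proof.
split; first by apply/asboolP; exists [::]; rewrite big_nil.
move=> a x y /asboolP[s [hs ->]] /asboolP[t [ht ->]]; apply/asboolP.
exists ([seq (a * p.1, p.2) | p <- s] ++ t); split.
  by move=> p; rewrite mem_cat => /orP[/mapP[q /hs hq ->]|/ht].
rewrite big_cat big_map scaler_sumr /=; congr (_ + _).
by apply: eq_bigr => p _; rewrite scalerA.
Qed.

HB.instance Definition _ :=
  GRing.isSubmodClosed.Build rat {malg rat[K]} relspan relspan_submod.

Definition presented : Type := Quotient.quot relspan.
HB.instance Definition _ := GRing.Zmodule.on presented.
HB.instance Definition _ :=
  EqQuotient.copy presented (Quotient.quot relspan).
HB.instance Definition _ :=
  ZmodQuotient.copy presented (Quotient.quot relspan).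

Fact presented_eq (x y : {malg rat[K]}) :
  (\pi_presented x == \pi_presented y) = (x - y \in relspan).
Proof. exact: esym (Quotient.idealrBE _ _ _). Qed.

Definition pscale (a : rat) (q : presented) : presented :=
  \pi_presented (a *: repr q).

Fact pscale_pi a x : pscale a (\pi_presented x) = \pi_presented (a *: x).
Proof.
apply/eqP; rewrite presented_eq -scalerBr rpredZ // -presented_eq.
by rewrite reprK.
Qed.

Fact pscaleA a b q : pscale a (pscale b q) = pscale (a * b) q.
Proof. by rewrite -[q]reprK [pscale b _]pscale_pi !pscale_pi scalerA. Qed.
Fact pscale1 : left_id 1 pscale.
Proof. by move=> q; rewrite -[q]reprK pscale_pi scale1r. Qed.
Fact pscaleDr : right_distributive pscale +%R.
Proof.
move=> a p q; rewrite -[p]reprK -[q]reprK.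
by rewrite -raddfD !pscale_pi scalerDr raddfD.
Qed.
Fact pscaleDl q : {morph pscale^~ q : a b / a + b}.
Proof.
by move=> a b; rewrite -[q]reprK !pscale_pi scalerDl raddfD.
Qed.
HB.instance Definition _ := GRing.Zmodule_isLmodule.Build rat presented
  pscaleA pscale1 pscaleDr pscaleDl.

Definition psym (k : K) : presented := \pi_presented (fgen k).

Variables (V : lmodType rat) (f : K -> V).

Definition linext (x : {malg rat[K]}) : V := \sum_(k <- msupp x) x@_k *: f k.

Fact linextEw (d : {fset K}) x :
  {subset msupp x <= d} -> linext x = \sum_(k <- d) x@_k *: f k.
Proof.
move=> h; rewrite /linext (big_fset_incl _ (B := d)) //; first exact/fsubsetP.
by move=> k _ /mcoeff_outdom ->; rewrite scale0r.
Qed.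

Fact linext_linear : linear linext.
Proof.
move=> a x y; pose d := (msupp x `|` msupp y)%fset.
rewrite !(@linextEw d) ?scaler_sumr -?big_split /=.
- by apply: eq_bigr => k _; rewrite mcoeffD mcoeffZ scalerDl scalerA.
- by move=> k hk; rewrite in_fsetU hk orbT.
- by move=> k hk; rewrite in_fsetU hk.
move=> k; rewrite -!mcoeff_neq0 mcoeffD mcoeffZ in_fsetU -!mcoeff_neq0.
by apply: contraNT; rewrite negb_or !negbK => /andP[/eqP-> /eqP->];
  rewrite mulr0 addr0.
Qed.
HB.instance Definition _ :=
  GRing.isLinear.Build rat {malg rat[K]} V _ linext linext_linear.

Fact linextB : {morph linext : x y / x - y}.
Proof. exact: raddfB. Qed.

Fact linextU k : linext (fgen k) = f k.
Proof.
rewrite fgen.unlock (@linextEw [fset k]%fset).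
  by rewrite big_seq_fset1 mcoeffUU scale1r.
by move=> j; rewrite msuppU oner_eq0.
Qed.

Definition plift of (forall r, rel r -> linext r = 0) : presented -> V :=
  fun q => linext (repr q).

Variable hf : forall r, rel r -> linext r = 0.

Fact plift_pi x : plift hf (\pi_presented x) = linext x.
Proof.
apply/eqP; rewrite -subr_eq0 /plift -raddfB.
have : repr (\pi_presented x) - x \in relspan by rewrite -presented_eq reprK.
move=> /asboolP[s [hs ->]]; rewrite raddf_sum big_seq big1 // => p /hs hp /=.
by rewrite linearZ /= hf // scaler0.
Qed.

Fact plift_linear : linear (plift hf).
Proof.
move=> a p q; rewrite -[p]reprK -[q]reprK.
by rewrite [a *: _]pscale_pi -raddfD !plift_pi linearP.
Qed.
HB.instance Definition _ :=
  GRing.isLinear.Build rat presented V _ (plift hf) plift_linear.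

Fact plift_psym k : plift hf (psym k) = f k.
Proof. by rewrite plift_pi linextU. Qed.

Fact psym_rel r : rel r -> \pi_presented r = 0.
Proof.
move=> hr; have <- : \pi_presented 0 = 0 by rewrite raddf0.
apply/eqP; rewrite presented_eq subr0; apply/asboolP; exists [:: (1, r)].
by split=> [p|]; rewrite ?big_seq1 ?scale1r // inE => /eqP->.
Qed.

End Presented.

(* Degree-two part of the symmetric algebra of V, i.e. the tensor square of V
   modulo the swap.  Linearity in the second variable follows from Sym2_comm. *)
Inductive sym2_rel (V : lmodType rat) : {malg rat[(V * V)%type]} -> Prop :=
| Sym2_add (x x' y : V) :
    sym2_rel (fgen (x + x', y) - fgen (x, y) - fgen (x', y))
| Sym2_scale (a : rat) (x y : V) :
    sym2_rel (fgen (a *: x, y) - a *: fgen (x, y))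
| Sym2_comm (x y : V) :
    sym2_rel (fgen (x, y) - fgen (y, x)).

Definition Sym2 (V : lmodType rat) : lmodType rat := presented (@sym2_rel V).

Definition sprod (V : lmodType rat) (x y : V) : Sym2 V :=
  psym (@sym2_rel V) (x, y).

Fact sprodDl (V : lmodType rat) (x x' y : V) :
  sprod (x + x') y = sprod x y + sprod x' y.
Proof.
apply/eqP; rewrite -subr_eq0 opprD addrA; apply/eqP.
by rewrite -(psym_rel (Sym2_add x x' y)) !raddfB.
Qed.

Fact sprodC (V : lmodType rat) (x y : V) : sprod x y = sprod y x.
Proof.
by apply: subr0_eq; rewrite -(psym_rel (Sym2_comm x y)) raddfB.
Qed.

Section PartialBasis.
Variable A : zmodType.
Implicit Types (L : A -> Prop) (b s : seq A).

Definition zcomb (c : seq int) b : A := \sum_(i < size b) b`_i *~ c`_i.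

Definition is_basis L b : Prop :=
  (forall x, x \in b -> L x) /\
  (forall x, L x -> exists! c : seq int, size c = size b /\ x = zcomb c b).

(* A list with a repeated vector is never a partial basis. *)
Definition partial_basis L s : Prop := exists t, is_basis L (s ++ t).

End PartialBasis.

Section BasisTheory.
Variable A : zmodType.
Implicit Types (L : A -> Prop) (b t : seq A).

Fact zcomb_cons (a : int) c (x : A) b :
  zcomb (a :: c) (x :: b) = x *~ a + zcomb c b.
Proof. by rewrite /zcomb big_ord_recl. Qed.

Fact basis_shear L t x y x' y' (f h : int * int -> int * int) :
  cancel f h -> cancel h f -> L x' -> L y' ->
  (forall p, x *~ p.1 + y *~ p.2 = x' *~ (f p).1 + y' *~ (f p).2) ->
  is_basis L (x :: y :: t) -> is_basis L (x' :: y' :: t).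
Proof.
move=> fK hK Lx' Ly' E [hL hb]; split=> [z|z Lz].
  rewrite !inE => /or3P[/eqP->|/eqP->|zt] //; apply: hL.
  by rewrite !inE zt !orbT.
have [cc [[hs hz] uz]] := hb z Lz.
case: cc hs hz uz => [|c [|d cs]] /= hs hz uz; try discriminate hs.
case: hs => hs.
exists ((f (c, d)).1 :: (f (c, d)).2 :: cs); split.
  split; first by rewrite /= hs.
  by move: hz; rewrite !zcomb_cons !addrA => ->; rewrite (E (c, d)).
move=> [|c' [|d' cs']] [/= hs' hz']; try discriminate hs'.
case: hs' => hs'.
have [-> -> ->] : [:: c, d & cs] = [:: (h (c', d')).1, (h (c', d')).2 & cs'].
  apply: uz; split; first by rewrite /= hs'.
  by rewrite hz' !zcomb_cons !addrA (E (h (c', d'))) hK.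
by rewrite -surjective_pairing hK.
Qed.

Fact basis_swap L t x y :
  is_basis L (x :: y :: t) -> is_basis L (y :: x :: t).
Proof.
move=> B; have [hL _] := B.
apply: (basis_shear (f := fun p => (p.2, p.1)) (h := fun p => (p.2, p.1))) B.
- by case.
- by case.
- by apply: hL; rewrite !inE eqxx orbT.
- by apply: hL; rewrite !inE eqxx.
by move=> p; rewrite addrC.
Qed.

Fact basis_add L t x y :
  L (x + y) -> is_basis L (x :: y :: t) -> is_basis L (x + y :: y :: t).
Proof.
move=> Lxy B; have [hL _] := B.
apply: (basis_shear (f := fun p => (p.1, p.2 - p.1))
                    (h := fun p => (p.1, p.2 + p.1))) B => //.
- by case=> a d; rewrite subrK.
- by case=> a d; rewrite addrK.
- by apply: hL; rewrite !inE eqxx orbT.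
by move=> p; rewrite /= mulrzDl mulrzBr -addrA [y *~ p.1 + _]addrC subrK.
Qed.

End BasisTheory.

Section Lattice.
Variable g : nat.

Definition H : lmodType rat := 'rV[rat]_(g + g).
Definition HZ := 'rV[int]_(g + g).

Definition toH (v : HZ) : H := map_mx intr v.

Definition Jmx (R : comNzRingType) : 'M[R]_(g + g) :=
  block_mx 0 1%:M (- 1%:M) 0.

Definition omega (R : comNzRingType) (x y : 'rV[R]_(g + g)) : R :=
  (x *m Jmx R *m y^T) 0 0.

Fact omega_toH (x y : HZ) : omega (toH x) (toH y) = (omega x y)%:~R.
Proof.
rewrite /omega [Jmx _](_ : _ = map_mx intr (Jmx int)).
  by rewrite /toH map_trmx -!map_mxM mxE.
by rewrite /Jmx map_block_mx map_mxN !map_mx1 !map_mx0.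
Qed.

Definition primitive (v : HZ) : Prop := partial_basis (fun _ => True) [:: v].

Definition perp (v : HZ) : HZ -> Prop := fun w => omega v w = 0.

Definition zs_gen : choiceType := {p : HZ * HZ |
  `[< [/\ primitive p.1, primitive p.2 & omega p.1 p.2 = 0] >]}.

Definition mkzs (v1 v2 : HZ) (p1 : primitive v1) (p2 : primitive v2)
    (o12 : omega v1 v2 = 0) : zs_gen :=
  exist _ (v1, v2) (introT (asboolP _) (And3 p1 p2 o12)).

Inductive zs_rel : {malg rat[zs_gen]} -> Prop :=
| Zs_sym (v1 v2 : HZ) (p1 : primitive v1) (p2 : primitive v2)
    (o12 : omega v1 v2 = 0) (o21 : omega v2 v1 = 0) :
    zs_rel (fgen (mkzs p2 p1 o21) - fgen (mkzs p1 p2 o12))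
| Zs_add (v w1 w2 : HZ) (p : primitive v)
    (p1 : primitive w1) (p2 : primitive w2) (p12 : primitive (w1 + w2))
    (o1 : omega v w1 = 0) (o2 : omega v w2 = 0) (o12 : omega v (w1 + w2) = 0) :
    partial_basis (perp v) [:: w1; w2] ->
    zs_rel (fgen (mkzs p p12 o12) - fgen (mkzs p p1 o1) - fgen (mkzs p p2 o2)).

Definition Zs : lmodType rat := presented zs_rel.

Definition zs_sym (v1 v2 : HZ) (p1 : primitive v1) (p2 : primitive v2)
    (o12 : omega v1 v2 = 0) : Zs :=
  psym zs_rel (mkzs p1 p2 o12).

Definition Phi_gen (a : zs_gen) : Sym2 H :=
  sprod (toH (val a).1) (toH (val a).2).

Fact Phi_gen_rel r : zs_rel r -> linext Phi_gen r = 0.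
Proof.
case=> [v1 v2 p1 p2 o12 o21|v w1 w2 p p1 p2 p12 o1 o2 o12 _].
  by rewrite linextB !linextU /Phi_gen /= [X in X - _]sprodC subrr.
rewrite 2!linextB !linextU /Phi_gen /=.
have -> : toH (w1 + w2) = toH w1 + toH w2 :> H by rewrite /toH map_mxD.
by rewrite ![sprod (toH v) _]sprodC sprodDl -addrA -opprD subrr.
Qed.

Definition Phi : {linear Zs -> Sym2 H} := plift Phi_gen_rel.

Fact Phi_zs_sym v1 v2 p1 p2 o12 :
  Phi (@zs_sym v1 v2 p1 p2 o12) = sprod (toH v1) (toH v2).
Proof. exact: plift_psym. Qed.

End Lattice.

Section Perp.
Variable g : nat.
Implicit Types (u v w x y : HZ g).

Fact omegaC x y : omega y x = - omega x y.
Proof.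
have JT : (Jmx g int)^T = - Jmx g int.
  by rewrite /Jmx tr_block_mx opp_block_mx linearN /= !trmx0 !trmx1 !oppr0 ?opprK.
have -> : omega x y = (x *m Jmx g int *m y^T)^T 0 0 by rewrite mxE.
by rewrite !trmx_mul trmxK JT mulNmx mulmxN mulmxA /omega [X in - X]mxE opprK.
Qed.

Fact omegaDr v x y : omega v (x + y) = omega v x + omega v y.
Proof. by rewrite /omega linearD mulmxDr mxE. Qed.

Fact omegaMzr v x (a : int) : omega v (x *~ a) = omega v x * a.
Proof.
by rewrite -scaler_int intz /omega linearZ -scalemxAr mxE mulrC.
Qed.

Fact omega_zcomb v c (b : seq (HZ g)) :
  (forall x, x \in b -> perp v x) -> omega v (zcomb c b) = 0.
Proof.
move=> hb; rewrite /zcomb; elim/big_rec: _ => [|i x _ IH].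
  by rewrite /omega linear0 mulmx0 mxE.
by rewrite omegaDr IH omegaMzr hb ?mul0r ?addr0 ?mem_nth.
Qed.

Fact primitive_dual v : primitive v -> exists u, omega v u = 1.
Proof.
case=> t [_ /(_ _ I) hb].
have /choice[c hc] : forall x, exists c : seq int,
    (size c = (size t).+1 /\ x = zcomb c (v :: t)) /\
    forall c', size c' = (size t).+1 /\ x = zcomb c' (v :: t) -> c = c'.
  by move=> x; have [c [? ?]] := hb x; exists c.
pose phi (x : HZ g) : int := (c x)`_0.
have phiB : zmod_morphism phi.
  move=> x y; rewrite /phi.
  have [[sx ex] _] := hc x; have [[sy ey] _] := hc y.
  have -> : c (x - y) = mkseq (fun i => (c x)`_i - (c y)`_i) (size t).+1.
    apply: (hc _).2; rewrite size_mkseq; split=> //.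
    rewrite {1}ex {1}ey /zcomb -sumrB; apply: eq_bigr => i _.
    by rewrite nth_mkseq // mulrzBr.
  by rewrite nth_mkseq.
have phiv : phi v = 1.
  rewrite /phi; have -> // : c v = 1 :: nseq (size t) 0.
  apply: (hc v).2; rewrite /= size_nseq; split=> //.
  rewrite zcomb_cons mulr1z /zcomb big1 ?addr0 // => i _.
  by rewrite nth_nseq if_same mulr0z.
pose mix := GRing.isZmodMorphism.Build _ _ phi phiB.
pose F : {additive HZ g -> int} := HB.pack phi mix.
pose p : HZ g := \row_i phi (delta_mx 0 i).
have phiE x : phi x = (x *m p^T) 0 0.
  rewrite -[phi]/(F : HZ g -> int) {1}[x]row_sum_delta raddf_sum mxE.
  apply: eq_bigr => i _; rewrite !mxE -[x 0 i in LHS]intz scaler_int raddfMz.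
  by rewrite -mulrzr intz mulrC.
exists (- (p *m (Jmx g int)^T)).
rewrite /omega linearN /= trmx_mul trmxK mulmxN !mulmxA -[v *m _ *m _]mulmxA.
have -> : Jmx g int *m Jmx g int = - 1%:M.
  rewrite /Jmx mulmx_block !mul0mx !mulmx0 !mulmx1 !mul1mx !add0r !addr0.
  by rewrite scalar_mx_block opp_block_mx !oppr0.
by rewrite mulmxN mulmx1 mulNmx opprK -phiE.
Qed.

Fact perp_primitive v w s :
  primitive v -> is_basis (perp v) (w :: s) -> primitive w.
Proof.
move=> /primitive_dual[u vu] [hL hb]; exists (u :: s); apply: basis_swap.
split=> // x _; pose y := x - u *~ omega v x.
have hy : perp v y.
  by rewrite /perp /y -mulrNz omegaDr omegaMzr vu mul1r subrr.
have [c [[sc ec] uc]] := hb y hy; exists (omega v x :: c); split.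
  by rewrite /= sc zcomb_cons -ec addrC subrK.
case=> [|a c'] [/= sc' ec']; first by [].
case: sc' => sc'.
have ha : omega v x = a.
  by rewrite ec' zcomb_cons omegaDr omega_zcomb // addr0 omegaMzr vu mul1r.
rewrite -ha (uc c') // ; split=> //.
by rewrite /y {1}ec' zcomb_cons ha addrC addKr.
Qed.

(* Hence the conditions on w1, w2 and w1 + w2 in Zs_add are automatic; so is o21
   in Zs_sym, by omegaC. *)
Fact zs_add_gen v w1 w2 :
  primitive v -> partial_basis (perp v) [:: w1; w2] ->
  [/\ primitive w1, primitive w2, primitive (w1 + w2)
    & [/\ omega v w1 = 0, omega v w2 = 0 & omega v (w1 + w2) = 0]].
Proof.
move=> pv [t B]; have [hL _] := B.
have h1 : omega v w1 = 0 by apply: hL; rewrite !inE eqxx.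
have h2 : omega v w2 = 0 by apply: hL; rewrite !inE eqxx orbT.
have h3 : omega v (w1 + w2) = 0 by rewrite omegaDr h1 h2 addr0.
split=> //; apply: (perp_primitive pv).
- exact: B.
- exact: basis_swap B.
- exact: basis_add B.
Qed.

End Perp.

(* Main.v *)
Require Import Defs.
From HB Require Import structures.
From mathcomp Require Import all_boot all_order all_algebra.
From mathcomp Require Import generic_quotient finmap boolp monalg zify ring.
Import GRing.Theory Num.Theory.
Local Open Scope ring_scope.
Local Open Scope quotient_scope.

Set Implicit Arguments.
Unset Strict Implicit.
Unset Printing Implicit Defensive.

(** Write [v, w] for the generator attached to orthogonal primitive v and w,
    and q(v) = [v, v]. The inverse of Phi is built from a symmetric bilinear
    form B on H with values in the presented space: B is prescribed on the
    standard symplectic basis a_i, b_i by B(x, y) = [x, y] for orthogonal basis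
    vectors and by 2 B(a_i, b_i) = q(a_i + b_i) - q(a_i) - q(b_i). It induces a
    linear map from Sym^2(H), and Phi composed after it is the identity by a
    direct computation ([gram_form], [PhiK]). The content is that the other
    composite is the identity too, that is, B(v, w) = [v, w] for all orthogonal
    primitive v and w. Three facts give it.

    Linearity ([br_additive]). For primitive v, the function [v, -] is the
    restriction of an additive function on the orthogonal complement of v. The
    defining relation says that [v, -] is additive on pairs of vectors of a
    basis of that complement. Euclid's algorithm turns a given basis into one
    containing a given primitive vector up to sign, by shears of two basis
    vectors, and each shear keeps the additive extension of [v, -] unchanged.

    Two identities beyond linearity. For orthogonal hyperbolic pairs (a1, b1)
    and (a2, b2), let M = [a1 + a2, b1 - b2] + [a1, b2] - [a2, b1], and let
    k(x, y) = q(x + y) - q(x) - q(y). By linearity, the quarter turn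
    (a2, b2) -> (b2, - a2) changes M by k(a2, b2). Four quarter turns are the
    identity, hence k(x, y) + k(y, - x) = 0 for x = a2 and y = b2, which is the
    parallelogram law ([polar_turn]), and two of them preserve M. Expanding
    [u + w, u - w] with u = a1 + b1 and w = a2 + b2 in two ways then gives
    2 M = k(a1, b1) - k(a2, b2) ([mixed_polar]). The second pair exists because
    g >= 2.

    Propagation ([realized_unimod]). Say that B realizes a symplectic basis
    when B(x, -) = [x, -] for each basis vector x and B(a_i + b_i, a_i + b_i) =
    q(a_i + b_i). The two identities show that this property survives the moves
    (a_i, b_i) -> (b_i, - a_i), b_i -> b_i +- a_i, and a_j -> a_j + a_i with
    b_i -> b_i - b_j. These moves suffice for a Euclidean algorithm which
    brings any primitive vector into the basis ([sympl_reduce]), so B realizes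
    the bracket at every primitive vector. *)

(** * The symplectic form on the lattice *)

Section Form.
Variable g : nat.
Implicit Types (u v w x y z : HZ g).

(** Primitivity in a form that is checked by exhibiting one vector; see
    [primitiveP]. *)
Definition unimod v : Prop := exists u, omega v u = 1.

Lemma omegaDl x y v : omega (x + y) v = omega x v + omega y v.
Proof. by rewrite omegaC omegaDr opprD -!omegaC. Qed.

Lemma omegaNr v x : omega v (- x) = - omega v x.
Proof. by rewrite -[- x]mulrN1z omegaMzr mulrN1. Qed.

Lemma omegaNl v x : omega (- x) v = - omega x v.
Proof. by rewrite omegaC omegaNr -omegaC. Qed.

Lemma omegaMzl v x (a : int) : omega (x *~ a) v = omega x v * a.
Proof. by rewrite omegaC omegaMzr -mulNr -omegaC. Qed.

Lemma omegavv v : omega v v = 0.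
Proof. by have := omegaC v v; lia. Qed.

Lemma omega0r v : omega v 0 = 0.
Proof. by rewrite -(subrr v) omegaDr omegaNr subrr. Qed.

Lemma omega_suml (I : Type) (r : seq I) (D : pred I) (F : I -> HZ g) v :
  omega (\sum_(i <- r | D i) F i) v = \sum_(i <- r | D i) omega (F i) v.
Proof.
apply: (big_morph (fun x => omega x v)) => [x y|]; first exact: omegaDl.
by rewrite omegaC omega0r oppr0.
Qed.

Definition omegaE := (omegaDl, omegaDr, omegaNl, omegaNr, omegavv).

Lemma unimodN v : unimod v -> unimod (- v).
Proof. by move=> [u vu]; exists (- u); rewrite omegaNl omegaNr opprK. Qed.

End Form.

(** * Updates and shears of finite families *)
Definition upd (I : eqType) (T : Type) (f : I -> T) (i : I) (x : T) : I -> T :=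
  fun k => if k == i then x else f k.

Lemma updE (I : eqType) (T : Type) (f : I -> T) i x : upd f i x i = x.
Proof. by rewrite /upd eqxx. Qed.

Lemma upd_neq (I : eqType) (T : Type) (f : I -> T) i x k :
  k != i -> upd f i x k = f k.
Proof. by rewrite /upd => /negPf->. Qed.

(** A shear of the vectors is compensated by the opposite shear of the
    coefficients. *)
Lemma sum_shear (I : finType) (V : zmodType) (D : pred I) (F : I -> V)
    (c : I -> int) i j (m : int) : D i -> D j -> i != j ->
  \sum_(k | D k) upd F j (F j + F i *~ m) k *~ upd c i (c i - c j * m) k
    = \sum_(k | D k) F k *~ c k.
Proof.
move=> Di Dj ij; have Dji : D j && (j != i) by rewrite Dj eq_sym.
rewrite [LHS](bigD1 i) //= (bigD1 j) //=.
rewrite [RHS](bigD1 i) //= [in RHS](bigD1 j) //=.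
rewrite !updE !upd_neq // 1?eq_sym // !addrA; congr (_ + _); last first.
  by apply: eq_bigr => k /andP[/andP[_ ki] kj]; rewrite !upd_neq.
by rewrite mulrzBr mulrzDl -mulrzA [m * _]mulrC [F j *~ _ + _]addrC addrA subrK.
Qed.

Lemma eq_sum_off2 (I : finType) (V : nmodType) (F G : I -> V) i j :
  i != j -> (forall k, k != i -> k != j -> F k = G k) ->
  F i + F j = G i + G j -> \sum_k F k = \sum_k G k.
Proof.
move=> ij FG FGij; have ji : j != i by rewrite eq_sym.
rewrite (bigD1 i) // (bigD1 j) //= addrA FGij.
rewrite [RHS](bigD1 i) // [in RHS](bigD1 j) //= addrA; congr (_ + _).
by apply: eq_bigr => k /andP[ki kj]; apply: FG.
Qed.

Lemma sum_upd_lt (I : finType) (D : pred I) (c : I -> nat) i (x : nat) :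
  D i -> (x < c i)%N ->
  (\sum_(k | D k) upd c i x k < \sum_(k | D k) c k)%N.
Proof.
move=> Di lt_x; rewrite (bigD1 i) //= [in X in (_ < X)%N](bigD1 i) //= updE.
rewrite -addSn leq_add // leq_eqVlt; apply/orP; left; apply/eqP.
by apply: eq_bigr => k /andP[_ ki]; rewrite upd_neq.
Qed.

(** Subtracting one multiple at a time keeps every move an elementary shear. *)
Lemma euclid_step (a b : int) : b != 0 -> (`|b| <= `|a|)%N ->
  exists2 m : int, m = 1 \/ m = -1 & (`|(a - b * m)%R| < `|a|)%N.
Proof.
move=> b0 ba; have [ab|ab] := boolP ((0 <= a) == (0 <= b)).
  by exists 1; [left|lia].
by exists (-1); [right|lia].
Qed.

Lemma mulz_eq1 (a b : int) : a * b = 1 -> a = 1 \/ a = -1.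
Proof.
move=> ab; have : (`|a| * `|b|)%N = 1%N by rewrite -abszM ab.
by move/eqP; rewrite muln_eq1 => /andP[/eqP a1 _]; lia.
Qed.

(** * Euclid's algorithm on bases of a sublattice *)
Section DualBasis.
Variables (g : nat) (I : finType) (L : HZ g -> Prop) (D : pred I).
Implicit Types (e d : I -> HZ g).

(** The form represents the coordinates of a basis e of L by vectors d of the
    ambient lattice, which need not lie in L. The predicate D lets two
    sublattices share one index type. *)
Definition dual_basis e d : Prop :=
  [/\ forall k, D k -> L (e k),
      forall k l, D k -> D l -> omega (e k) (d l) = (k == l)%:R
    & forall x, L x -> x = \sum_(k | D k) e k *~ omega x (d k)].

Lemma zcomb_map (T : Type) (e : T -> HZ g) (c : T -> int) (s : seq T) :
  zcomb [seq c k | k <- s] [seq e k | k <- s] = \sum_(k <- s) e k *~ c k.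
Proof.
elim: s => [|k s IH]; first by rewrite /zcomb big_ord0 big_nil.
by rewrite /= zcomb_cons IH big_cons.
Qed.

Lemma dual_basis_coord e d (s : seq I) (c : I -> int) l :
  dual_basis e d -> uniq s -> s =i D -> l \in s ->
  omega (\sum_(k <- s) e k *~ c k) (d l) = c l.
Proof.
move=> [_ ed _] us sD ls; rewrite omega_suml (bigD1_seq l) //= omegaMzl.
have Ds k : k \in s -> D k by rewrite sD.
rewrite ed ?Ds // eqxx mul1r big_seq_cond big1 ?addr0 // => k /andP[ks kl].
by rewrite omegaMzl ed ?Ds // (negPf kl) mul0r.
Qed.

Lemma dual_basis_is_basis e d (s : seq I) :
  dual_basis e d -> uniq s -> s =i D -> is_basis L [seq e k | k <- s].
Proof.
move=> ed us sD; have [Le _ span] := ed; split=> [x /mapP[k ks ->]|x Lx].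
  by apply: Le; rewrite -[D k]/(k \in D) -sD.
exists [seq omega x (d k) | k <- s]; split.
  by rewrite !size_map zcomb_map big_uniq // (eq_bigl _ _ sD) -span.
move=> c []; rewrite size_map => sc ->.
have -> : c = [seq c`_(index k s) | k <- s].
  apply: (@eq_from_nth _ 0); rewrite ?size_map // sc => i ltis.
  have k0 : I by case: (s) ltis.
  by rewrite (nth_map k0) // index_uniq.
by rewrite zcomb_map; apply/eq_in_map => l ls; apply: dual_basis_coord.
Qed.

Lemma dual_basis_pair e d i j :
  dual_basis e d -> D i -> D j -> i != j -> partial_basis L [:: e i; e j].
Proof.
move=> ed Di Dj ij; pose s := [seq k <- enum D | k \notin [:: i; j]].
exists [seq e k | k <- s].
apply: (@dual_basis_is_basis e d [:: i, j & s]) => //.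
  rewrite /= !inE !mem_filter !inE !eqxx orbT /= orbF ij /= filter_uniq //.
  exact: enum_uniq.
move=> k; rewrite !inE mem_filter mem_enum !inE.
by have [->|ki] := eqVneq k i; [|have [->|kj] := eqVneq k j].
Qed.

(** A shear of two vectors of a basis is matched by the opposite shear of the
    dual vectors. *)
Lemma dual_basis_shear e d i j (m : int) :
  dual_basis e d -> (forall x y, L x -> L y -> L (x + y *~ m)) ->
  D i -> D j -> i != j ->
  dual_basis (upd e j (e j + e i *~ m)) (upd d i (d i - d j *~ m)).
Proof.
move=> [Le ed span] LD Di Dj ij; split=> [k Dk|k l Dk Dl|x Lx].
- by rewrite /upd; case: eqP => _; [apply: LD|]; apply: Le.
- rewrite /upd; case: (eqVneq k j) => [->|kj]; case: (eqVneq l i) => [->|li];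
    rewrite ?(omegaDl, omegaDr, omegaNr, omegaMzr, omegaMzl) !ed //.
  + by rewrite !eqxx eq_sym (negPf ij); lia.
  + by rewrite [i == l]eq_sym (negPf li); lia.
  + by rewrite (negPf kj); lia.
- rewrite {1}[x]span // -(sum_shear _ (fun k => omega x (d k)) m Di Dj ij).
  apply: eq_bigr => k _; rewrite /upd; congr (_ *~ _).
  by case: eqP => // _; rewrite omegaDr omegaNr omegaMzr.
Qed.

Variables (V : zmodType) (f : HZ g -> V).
Hypothesis LD : forall x y (m : int), L x -> L y -> L (x + y *~ m).
Hypothesis fD : forall x y, partial_basis L [:: x; y] -> f (x + y) = f x + f y.

(** The pairs (e i, e j) and (- e j, e i + e j) both extend to a basis, and
    e i is the sum of the second one. *)
Lemma dual_basis_fN e d i j :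
  dual_basis e d -> D i -> D j -> i != j -> f (- e j) = - f (e j).
Proof.
move=> ed Di Dj ij; have ji : j != i by rewrite eq_sym.
have Efij := fD (dual_basis_pair ed Di Dj ij).
have LD' m x y : L x -> L y -> L (x + y *~ m) by move=> *; apply: LD.
have ed1 := dual_basis_shear ed (LD' 1) Di Dj ij.
have ed2 := dual_basis_shear ed1 (LD' (-1)) Dj Di ji.
have := fD (dual_basis_pair ed2 Di Dj ij).
rewrite !(updE, upd_neq) // mulr1z mulrN1z [e j + e i]addrC.
rewrite opprD addNKr addrCA addNr addr0.
by rewrite Efij addrCA -[LHS]addr0 => /addrI/esym/eqP; rewrite addr_eq0 => /eqP.
Qed.

Lemma dual_basis_fshear e d i j (m : int) :
  dual_basis e d -> D i -> D j -> i != j -> m = 1 \/ m = -1 ->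
  f (e j + e i *~ m) = f (e j) + f (e i) *~ m.
Proof.
move=> ed Di Dj ij [] ->; have ji : j != i by rewrite eq_sym.
  by rewrite !mulr1z fD //; apply: dual_basis_pair ed _ _ _.
have LD' x y : L x -> L y -> L (x + y *~ (-1)) by apply: LD.
have ed1 := dual_basis_shear ed LD' Di Dj ij.
have := fD (dual_basis_pair ed1 Dj Di ji).
by rewrite updE upd_neq // !mulrN1z subrK => ->; rewrite addrK.
Qed.

(** Euclid's algorithm on the coordinates of w, run by shears of the basis: a
    shear preserves the additive extension of f from the basis, because f is
    additive on pairs of basis vectors, and the algorithm ends with w equal to
    a basis vector up to sign. The indices i0 and j0 provide a second basis
    vector, without which f (- e i0) would be unconstrained. *)
Lemma additive_on_unimod e d i0 j0 w :
  dual_basis e d -> D i0 -> D j0 -> i0 != j0 -> L w -> unimod w ->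
  f w = \sum_(k | D k) f (e k) *~ omega w (d k).
Proof.
move=> + Di0 Dj0 ij0 Lw [u wu].
have [n] := ubnP (\sum_(k | D k) `|omega w (d k)|)%N.
elim: n e d => // n IH e d; rewrite ltnS => le_n ed; pose c k := omega w (d k).
(* As long as two coordinates are nonzero, the larger one can be decreased. *)
have [[i j] /= /and5P[Di Dj ij cj0 ji]|none] := pickP (fun p : I * I =>
  [&& D p.1, D p.2, p.1 != p.2, c p.2 != 0 & (`|c p.2| <= `|c p.1|)%N]).
  have [m m1 lt_m] := euclid_step cj0 ji.
  have LD' x y : L x -> L y -> L (x + y *~ m) by apply: LD.
  have c'E k : omega w (upd d i (d i - d j *~ m) k) = upd c i (c i - c j * m) k.
    by rewrite /upd; case: eqP => // _; rewrite omegaDr omegaNr omegaMzr.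
  rewrite (IH _ _ _ (dual_basis_shear ed LD' Di Dj ij)); last first.
    apply: leq_trans le_n; apply: leq_ltn_trans (sum_upd_lt Di lt_m).
    by apply: leq_sum => k _; rewrite c'E /upd; case: eqP.
  rewrite -[RHS](sum_shear (fun k => f (e k)) c m Di Dj ij).
  apply: eq_bigr => k _; rewrite c'E; congr (_ *~ _).
  by rewrite /upd; case: eqP => // _; apply: (dual_basis_fshear ed).
have [_ _ /(_ w Lw) wE] := ed.
have [i Di ci0] : exists2 i, D i & c i != 0.
  have [i /andP[]|c0] := pickP (fun i => D i && (c i != 0)); first by exists i.
  suff w0 : w = 0 by move: wu; rewrite w0 omegaC omega0r.
  rewrite wE; apply: big1 => k Dk.
  by have := c0 k; rewrite Dk /= => /negbFE/eqP ck; rewrite -/(c k) ck mulr0z.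
have c0 k : D k && (k != i) -> c k = 0.
  case/andP=> Dk ki; apply/eqP.
  pose p := if (`|c k| <= `|c i|)%N then (i, k) else (k, i).
  apply: contraFT (none p) => ck; rewrite /p.
  by case: leqP => /= [le|/ltnW le]; apply/and5P; split; rewrite // eq_sym.
have wi : w = e i *~ c i.
  rewrite {1}wE (bigD1 i) //= big1 ?addr0 // => k Dk.
  by rewrite -/(c k) c0 // mulr0z.
rewrite (bigD1 i) //= big1 ?addr0 => [|k Dk]; last first.
  by rewrite -/(c k) c0 // mulr0z.
(* A unimodular vector is divisible by units only. *)
have ci1 : c i = 1 \/ c i = -1.
  by apply: (@mulz_eq1 _ (omega (e i) u)); rewrite mulrC -omegaMzl -wi.
rewrite -/(c i); case: ci1 => ci; rewrite {1}wi ci ?mulr1z // !mulrN1z.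
have [ii0|ii0] := eqVneq i i0.
  by apply: (dual_basis_fN ed Dj0 Di); rewrite ii0 eq_sym.
by apply: (dual_basis_fN ed Di0 Di); rewrite eq_sym.
Qed.

End DualBasis.

(** * Symplectic bases and their reduction *)
Section Symplectic.
Variable g : nat.
Implicit Types (a b : 'I_g -> HZ g) (u v w x y z : HZ g).

Definition sympl a b : Prop :=
  [/\ forall i j, omega (a i) (a j) = 0, forall i j, omega (b i) (b j) = 0,
      forall i j, omega (a i) (b j) = (i == j)%:R
    & forall x, x = \sum_i (a i *~ omega x (b i) + b i *~ omega (a i) x)].

Lemma omega_coord x y :
  omega x y = \sum_i (x 0 (lshift g i) * y 0 (rshift g i)
                      - x 0 (rshift g i) * y 0 (lshift g i)).
Proof.
rewrite /omega /Jmx -{1}[x]hsubmxK -[y in _ *m y^T]hsubmxK mul_row_block.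
rewrite !mulmx0 add0r addr0 mulmxN !mulmx1 tr_row_mx mul_row_col mulNmx addrC.
rewrite !mxE -sumrN -big_split; apply: eq_bigr => i _ /=.
by rewrite !mxE.
Qed.

Definition stda (i : 'I_g) : HZ g := delta_mx 0 (lshift g i).
Definition stdb (i : 'I_g) : HZ g := delta_mx 0 (rshift g i).

Lemma omega_stda i x : omega (stda i) x = x 0 (rshift g i).
Proof.
rewrite omega_coord (bigD1 i) //= big1 => [|k ki]; rewrite !mxE !eqxx /=.
  by rewrite eq_rlshift mul1r mul0r subr0 addr0.
by rewrite eq_lshift (negPf ki) eq_rlshift !mul0r subr0.
Qed.

Lemma omega_stdb i x : omega x (stdb i) = x 0 (lshift g i).
Proof.
rewrite omega_coord (bigD1 i) //= big1 => [|k ki]; rewrite !mxE !eqxx /=.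
  by rewrite eq_lrshift mulr1 mulr0 subr0 addr0.
by rewrite eq_rshift (negPf ki) eq_lrshift !mulr0 subr0.
Qed.

Lemma sympl_std : sympl stda stdb.
Proof.
split=> [i j|i j|i j|x].
- by rewrite omega_stda mxE eq_rlshift andbF.
- by rewrite omega_stdb mxE eq_lrshift andbF.
- by rewrite omega_stda mxE eq_rshift.
rewrite {1}[x]row_sum_delta big_split_ord /= -big_split.
apply: eq_bigr => i _ /=.
by rewrite omega_stdb omega_stda -!scaler_int !intz.
Qed.

Lemma symplE a b : sympl a b ->
  [/\ forall i j, omega (a i) (a j) = 0, forall i j, omega (b i) (b j) = 0,
      forall i j, omega (a i) (b j) = (i == j)%:R
    & forall i j, omega (b j) (a i) = - (i == j)%:R].
Proof. by move=> [aa bb ab _]; split=> // i j; rewrite omegaC ab. Qed.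

Lemma sympl_turn a b i :
  sympl a b -> sympl (upd a i (b i)) (upd b i (- a i)).
Proof.
move=> ab; have [aa bb e1 e2] := symplE ab; have [_ _ _ span] := ab.
split=> [j k|j k|j k|x].
- rewrite /upd; case: (eqVneq j i) => [Ej|ji]; case: (eqVneq k i) => [Ek|ki];
    rewrite ?e1 ?e2 ?aa ?bb ?Ej ?Ek 1?[i == _]eq_sym;
    by rewrite ?(negPf ji) ?(negPf ki) ?eqxx.
- rewrite /upd; case: (eqVneq j i) => [Ej|ji]; case: (eqVneq k i) => [Ek|ki];
    rewrite ?omegaNl ?omegaNr ?e1 ?e2 ?aa ?bb ?Ej ?Ek ?oppr0 ?opprK //.
    by rewrite eq_sym (negPf ki) oppr0.
  by rewrite eq_sym (negPf ji).
- rewrite /upd; case: (eqVneq j i) => [Ej|ji]; case: (eqVneq k i) => [Ek|ki];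
    rewrite ?omegaNl ?omegaNr ?e1 ?e2 ?aa ?bb ?Ej ?Ek ?eqxx ?oppr0 ?opprK //.
    by rewrite eq_sym (negPf ki).
  by rewrite (negPf ji).
rewrite {1}(span x); apply: eq_bigr => k _; rewrite /upd; case: eqP => // ->.
by rewrite omegaNr -omegaC omegaC addrC mulrNz mulNrz.
Qed.

Lemma sympl_shear a b i (m : int) :
  sympl a b -> sympl a (upd b i (b i + a i *~ m)).
Proof.
move=> ab; have [aa bb e1 e2] := symplE ab; have [_ _ _ span] := ab.
split=> // [j k|j k|x].
- rewrite /upd; case: (eqVneq j i) => [Ej|ji]; case: (eqVneq k i) => [Ek|ki];
    rewrite ?(omegaDl, omegaDr, omegaMzl, omegaMzr);
    rewrite ?e1 ?e2 ?aa ?bb ?Ej ?Ek ?eqxx //.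
  + by lia.
  + by rewrite eq_sym (negPf ki); lia.
  + by rewrite eq_sym (negPf ji); lia.
- rewrite /upd; case: (eqVneq k i) => [Ek|ki] //; rewrite Ek.
  by rewrite ?(omegaDl, omegaDr, omegaMzl, omegaMzr) aa e1; lia.
rewrite {1}(span x); apply: eq_bigr => k _; rewrite /upd; case: eqP => // ->.
rewrite omegaDr omegaMzr [omega x (a i)]omegaC mulrzDl mulrzDr -mulrzA.
by rewrite mulNr [m * _]mulrC mulrNz addrACA addNr ?add0r ?addr0 // addrA.
Qed.

(** The symplectic extension of the basis change a_j += a_i of a Lagrangian. *)
Lemma sympl_mix a b i j : i != j ->
  sympl a b -> sympl (upd a j (a j + a i)) (upd b i (b i - b j)).
Proof.
move=> ij ab; have [aa bb e1 e2] := symplE ab; have [_ _ _ span] := ab.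
split=> [k l|k l|k l|x].
- by rewrite /upd; case: eqP => _; case: eqP => _; rewrite ?omegaE ?aa.
- rewrite /upd; case: eqP => _; case: eqP => _;
    by rewrite ?omegaE ?bb ?oppr0 ?addr0.
- rewrite /upd; case: (eqVneq k j) => [Ek|kj]; case: (eqVneq l i) => [El|li];
    rewrite ?omegaE ?e1 ?Ek ?El ?eqxx //.
  + by rewrite eq_sym (negPf ij); lia.
  + by rewrite [i == l]eq_sym (negPf li); lia.
  + by rewrite (negPf kj); lia.
have ji : j != i by rewrite eq_sym.
rewrite {1}(span x); apply: (eq_sum_off2 ij) => [k ki kj|].
  by rewrite !upd_neq.
rewrite !updE !upd_neq // !omegaE.
by apply/rowP => t; rewrite -!scaler_int !mxE !intz; ring.
Qed.

Section Reduction.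
Variable P : ('I_g -> HZ g) -> ('I_g -> HZ g) -> Prop.
Hypothesis P_turn : forall a b i,
  sympl a b -> P a b -> P (upd a i (b i)) (upd b i (- a i)).
Hypothesis P_shear : forall a b i (m : int), m = 1 \/ m = -1 ->
  sympl a b -> P a b -> P a (upd b i (b i + a i *~ m)).
Hypothesis P_mix : forall a b i j, i != j ->
  sympl a b -> P a b -> P (upd a j (a j + a i)) (upd b i (b i - b j)).

(** A half turn of one pair is two quarter turns. *)
Lemma sympl_opp a b i : sympl a b -> P a b ->
  sympl (upd a i (- a i)) (upd b i (- b i)) /\
  P (upd a i (- a i)) (upd b i (- b i)).
Proof.
move=> ab Pab; have ab1 := sympl_turn i ab; have P1 := P_turn i ab Pab.
have := P_turn i ab1 P1; have := sympl_turn i ab1; rewrite !updE.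
have uu (f : 'I_g -> HZ g) x y : upd (upd f i x) i y = upd f i y.
  by apply/funext => k; rewrite /upd; case: eqP.
by rewrite !uu.
Qed.

(** Turns and shears act on the pair (a i, b i) as Euclid's algorithm on the
    two coordinates of v there, and remove the coordinate along b i; mixes then
    do the same for the coordinates along the a i. The moves are restricted to
    these three, with a sign only on the shear, so that few invariances of P
    have to be checked. *)
Lemma sympl_reduce a b v : sympl a b -> P a b -> unimod v ->
  exists a' b' i, [/\ sympl a' b', P a' b' & v = a' i].
Proof.
move=> + + [u vu].
(* The unequal weights make a turn that moves the larger coordinate from b to a
   decrease the measure. *)
pose mu a b k := (2 * `|omega v (b k)| + 3 * `|omega (a k) v|)%N.
have [n] := ubnP (\sum_k mu a b k)%N; elim: n a b => // n IH a b.
rewrite ltnS => le_n ab Pab.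
have descend a' b' i (x : nat) : sympl a' b' -> P a' b' ->
    (forall k, mu a' b' k = upd (mu a b) i x k) -> (x < mu a b i)%N ->
    exists a' b' i, [/\ sympl a' b', P a' b' & v = a' i].
  move=> ab' Pab' mu' lt_x; apply: (IH a' b') => //; apply: leq_trans le_n.
  rewrite (eq_bigr _ (fun k _ => mu' k)).
  exact: (@sum_upd_lt _ predT).
have [i lt_i|d_le] := pickP (fun i => `|omega v (b i)| < `|omega (a i) v|)%N.
  pose x := (2 * `|omega (a i) v| + 3 * `|omega v (b i)|)%N.
  apply: (descend _ _ i x (sympl_turn i ab) (P_turn i ab Pab)) => [k|];
    last by rewrite /mu /x; lia.
  rewrite /mu /upd; case: eqP => // _.
  by rewrite omegaNr [omega (b i) v]omegaC [omega v (a i)]omegaC !abszN.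
have [i di0|d0] := pickP (fun i => omega (a i) v != 0).
  have := negbT (d_le i); rewrite -leqNgt => le_i.
  have [m m1 lt_m] := euclid_step di0 le_i.
  pose x := (2 * `|(omega v (b i) - omega (a i) v * m)%R|
             + 3 * `|omega (a i) v|)%N.
  apply: (descend _ _ i x (sympl_shear i m ab) (P_shear i m1 ab Pab)) => [k|];
    last by rewrite /mu /x; lia.
  rewrite /mu /upd; case: eqP => // ->.
  by rewrite omegaDr omegaMzr [omega v (a i)]omegaC mulNr.
have {d_le}d0 i : omega (a i) v = 0 by apply/eqP; rewrite -[_ == _]negbK d0.
have [[i j] /= /and3P[ij cj0 ji]|none] := pickP (fun p : 'I_g * 'I_g =>
  [&& p.1 != p.2, omega v (b p.2) != 0 &
      (`|omega v (b p.2)| <= `|omega v (b p.1)|)%N]).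
  (* A mix subtracts coordinates; when their signs differ, a half turn of the
     pair i, which does not change the measure, comes first. *)
  have [cc|cc] := boolP ((0 <= omega v (b i)) == (0 <= omega v (b j))).
    pose x := (2 * `|(omega v (b i) - omega v (b j))%R|)%N.
    apply: (descend _ _ i x (sympl_mix ij ab) (P_mix ij ab Pab)) => [k|];
      last by rewrite /mu /x; lia.
    rewrite /mu /upd; case: (eqVneq k j) => [->|kj];
      rewrite ?[j == i]eq_sym ?(negPf ij).
      by rewrite omegaDl !d0 addr0.
    by case: eqP => // _; rewrite d0 omegaDr omegaNr muln0 addn0.
  have [ab1 P1] := sympl_opp i ab Pab.
  pose x := (2 * `|(- omega v (b i) - omega v (b j))%R|)%N.
  apply: (descend _ _ i x (sympl_mix ij ab1) (P_mix ij ab1 P1)) => [k|];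
    last by rewrite /mu /x; lia.
  rewrite /mu /upd eqxx; case: (eqVneq k j) => [->|kj];
    rewrite ?[j == i]eq_sym ?(negPf ij).
    by rewrite omegaDl omegaNl !d0 oppr0 addr0.
  case: eqP => // _; rewrite omegaNl d0 omegaDr !omegaNr muln0 addn0.
  by rewrite /x -!opprD !abszN.
have [i ci0] : exists i, omega v (b i) != 0.
  have [i|c0] := pickP (fun i => omega v (b i) != 0); first by exists i.
  suff v0 : v = 0 by move: vu; rewrite v0 omegaC omega0r.
  have [_ _ _ /(_ v) ->] := ab; apply: big1 => k _.
  by move/negbFE/eqP: (c0 k) => ->; rewrite d0 !mulr0z addr0.
have vi : v = a i *~ omega v (b i).
  have [_ _ _ span] := ab; rewrite {1}(span v) (bigD1 i) //= big1 => [|k ki].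
    by rewrite d0 mulr0z !addr0.
  have ck : omega v (b k) = 0.
    apply/eqP; pose le_ki := (`|omega v (b k)| <= `|omega v (b i)|)%N.
    apply: contraFT (none (if le_ki then (i, k) else (k, i))) => ck.
    rewrite /le_ki.
    by case: leqP => /= [le|/ltnW le]; apply/and3P; split; rewrite // eq_sym.
  by rewrite ck d0 !mulr0z addr0.
have [c1|c1] : omega v (b i) = 1 \/ omega v (b i) = -1.
  by apply: (@mulz_eq1 _ (omega (a i) u)); rewrite mulrC -omegaMzl -vi.
  by exists a, b, i; split; rewrite // {1}vi c1.
have [ab1 P1] := sympl_opp i ab Pab.
exists (upd a i (- a i)), (upd b i (- b i)), i; split=> //.
by rewrite updE {1}vi c1 mulrN1z.
Qed.

End Reduction.
End Symplectic.

(** * Primitive vectors and their orthogonal complements *)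
Section Primitive.
Variable g : nat.
Implicit Types (a b : 'I_g -> HZ g) (v w x y : HZ g).

Definition pair_family (T : Type) (f h : 'I_g -> T) (k : 'I_g + 'I_g) : T :=
  match k with inl i => f i | inr i => h i end.

(** Since omega (a i) (b i) = 1, the coordinate along a i is paired out by b i,
    and the one along b i by - a i. *)
Lemma sympl_dual a b : sympl a b ->
  dual_basis (fun _ => True) predT
             (pair_family a b) (pair_family b (fun i => - a i)).
Proof.
move=> ab; have [aa bb e1 e2] := symplE ab; have [_ _ _ span] := ab.
split=> // [|x _].
  case=> i [] j _ _ /=; rewrite ?omegaNr ?e1 ?e2 ?aa ?bb ?opprK ?oppr0 //.
  by rewrite eq_sym.
rewrite {1}[x]span big_split big_sumType /=; congr (_ + _).
by apply: eq_bigr => i _; rewrite omegaNr -omegaC.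
Qed.

(** Orthogonality to a i is the vanishing of the coordinate along b i, so the
    complement of a i is spanned by the other basis vectors, a i included. *)
Lemma sympl_dual_perp a b i : sympl a b ->
  dual_basis (perp (a i)) (predC1 (inr i))
             (pair_family a b) (pair_family b (fun i => - a i)).
Proof.
move=> ab; have [_ ed span] := sympl_dual ab; have [aa bb e1 _] := symplE ab.
split=> [[] j /= ij|k l _ _|x px]; rewrite ?ed //.
  by rewrite /perp e1; have [E|//] := eqVneq i j; rewrite E eqxx in ij.
rewrite {1}[x]span // (bigD1 (inr i)) //= omegaNr -omegaC.
by rewrite [omega _ _]px mulr0z add0r.
Qed.

(** The reduction applied to the standard basis, with no invariant to carry. *)
Lemma unimod_sympl v : unimod v -> exists a b i, sympl a b /\ v = a i.
Proof.
move=> vu; have [//|//|//|a [b [i [ab _ ->]]]] :=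
  @sympl_reduce g (fun _ _ => True) _ _ _ _ _ v (sympl_std g) I vu.
by exists a, b, i.
Qed.

(** Unimodular vectors are members of symplectic bases, so every lattice vector
    pairing to 1 with another one extends to a basis. *)
Lemma primitiveP v : primitive v <-> unimod v.
Proof.
split=> [/primitive_dual //|vu].
have [a [b [i [ab ->]]]] := unimod_sympl vu.
pose s := [seq k <- enum {: 'I_g + 'I_g} | k != inl i].
exists [seq pair_family a b k | k <- s].
apply: (dual_basis_is_basis (s := inl i :: s) (sympl_dual ab)).
  by rewrite /= mem_filter eqxx filter_uniq // enum_uniq.
by move=> k; rewrite inE mem_filter mem_enum !inE andbT orbN.
Qed.

Lemma sympl_unimod_a a b i : sympl a b -> unimod (a i).
Proof. by case=> _ _ ab _; exists (b i); rewrite ab eqxx. Qed.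

Lemma sympl_unimod_b a b i : sympl a b -> unimod (b i).
Proof.
by case=> _ _ ab _; exists (- a i); rewrite omegaNr -omegaC ab eqxx.
Qed.

Lemma eq_on_perp (V : zmodType) (F G : {additive HZ g -> V}) a b i w :
  sympl a b -> omega (a i) w = 0 ->
  (forall k, F (a k) = G (a k)) -> (forall k, k != i -> F (b k) = G (b k)) ->
  F w = G w.
Proof.
move=> [_ _ _ span] aw Fa Fb; rewrite (span w) !raddf_sum.
apply: eq_bigr => k _.
rewrite !raddfD !raddfMz Fa; congr (_ + _).
by have [->|ki] := eqVneq k i; rewrite ?aw ?mulr0z // Fb.
Qed.

End Primitive.

(** * The bracket and its linearity *)
Section Bracket.
Variable g : nat.
Implicit Types (a b : 'I_g -> HZ g) (u v w x y : HZ g).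

(** The generators as a total function of two vectors, zero outside orthogonal
    primitive pairs: brackets can then be rewritten without carrying proofs. *)
Definition br v w : Zs g := oapp (psym (@zs_rel g)) 0 (insub (v, w)).

Lemma zs_sym_br v w (p1 : primitive v) (p2 : primitive w) (o : omega v w = 0) :
  zs_sym p1 p2 o = br v w.
Proof.
rewrite /br; case: insubP => [k _ kE|/negP[]] /=; last exact/asboolP.
by congr psym; apply: val_inj; rewrite kE.
Qed.

Lemma psym_br (k : zs_gen g) : psym (@zs_rel g) k = br (val k).1 (val k).2.
Proof. by rewrite /br -surjective_pairing valK. Qed.

Lemma brC v w : br v w = br w v.
Proof.
have [[pv pw vw]|nvw] := pselect [/\ primitive v, primitive w & omega v w = 0].
  have wv : omega w v = 0 by rewrite omegaC vw oppr0.
  rewrite -(zs_sym_br pv pw vw) -(zs_sym_br pw pv wv); apply/esym/subr0_eq.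
  by rewrite -(psym_rel (Zs_sym pv pw vw wv)) raddfB.
rewrite /br !insubN //; apply/asboolP => // -[/= pw pv wv]; apply: nvw.
by split; rewrite // omegaC wv oppr0.
Qed.

Lemma br_partial_basis v w1 w2 : primitive v ->
  partial_basis (perp v) [:: w1; w2] -> br v (w1 + w2) = br v w1 + br v w2.
Proof.
move=> pv pb; have [p1 p2 p12 [o1 o2 o12]] := zs_add_gen pv pb.
rewrite -(zs_sym_br pv p1 o1) -(zs_sym_br pv p2 o2) -(zs_sym_br pv p12 o12).
apply/eqP; rewrite -subr_eq0 opprD addrA; apply/eqP.
by rewrite -(psym_rel (Zs_add pv p1 p2 p12 o1 o2 o12 pb)) !raddfB.
Qed.

Hypothesis hg : (2 <= g)%N.

Lemma exists_other_pair (i : 'I_g) : exists j, j != i.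
Proof.
pose z := Ordinal (ltnW hg); pose o := Ordinal hg.
by have [->|iz] := eqVneq i z; [exists o | exists z; rewrite eq_sym].
Qed.

(** The vector v is a i in some symplectic basis, whose vectors except b i form
    a basis of its complement; the defining relation is the hypothesis of
    [additive_on_unimod]. *)
Lemma br_additive v : unimod v -> exists F : {additive HZ g -> Zs g},
  forall w, unimod w -> omega v w = 0 -> br v w = F w.
Proof.
move=> vu; have [a [b [i [ab vE]]]] := unimod_sympl vu.
pose e := pair_family a b; pose d := pair_family b (fun i => - a i).
pose F w := \sum_(k | predC1 (inr i) k) br v (e k) *~ omega w (d k).
have FB : zmod_morphism F.
  move=> x y; rewrite /F -sumrB; apply: eq_bigr => k _.
  by rewrite omegaDl omegaNl mulrzBr.
pose mix := GRing.isZmodMorphism.Build _ _ F FB.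
pose Fa : {additive HZ g -> Zs g} := HB.pack F mix.
exists Fa => w wu vw; have [j ji] := exists_other_pair i.
apply: (@additive_on_unimod g _ (perp v) _ _ (br v) _ _ e d (inl i) (inl j))
  => //.
- by move=> x y m xp yp; rewrite /perp omegaDr omegaMzr xp yp mul0r addr0.
- by move=> x y; apply: br_partial_basis; apply/primitiveP.
- by rewrite vE; apply: sympl_dual_perp.
- by rewrite eq_sym.
Qed.

Lemma brDr v x y : unimod v -> unimod x -> unimod y -> unimod (x + y) ->
  omega v x = 0 -> omega v y = 0 -> br v (x + y) = br v x + br v y.
Proof.
move=> vu xu yu xyu vx vy; have [F brF] := br_additive vu.
by rewrite !brF ?raddfD // omegaDr vx vy.
Qed.

Lemma brDl v x y : unimod v -> unimod x -> unimod y -> unimod (x + y) ->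
  omega x v = 0 -> omega y v = 0 -> br (x + y) v = br x v + br y v.
Proof.
move=> vu xu yu xyu xv yv.
by rewrite brC brDr ?[br v _]brC // omegaC ?xv ?yv oppr0.
Qed.

Lemma brNr v x : unimod v -> unimod x -> omega v x = 0 -> br v (- x) = - br v x.
Proof.
move=> vu xu vx; have [F brF] := br_additive vu.
by rewrite !brF ?raddfN ?omegaNr ?vx ?oppr0 //; apply: unimodN.
Qed.

Lemma brNl v x : unimod v -> unimod x -> omega x v = 0 -> br (- x) v = - br x v.
Proof.
by move=> vu xu xv; rewrite brC brNr 1?[br v _]brC // omegaC xv oppr0.
Qed.

End Bracket.

(** * Deciding identities in abelian groups *)
Inductive zexpr := ZVar of nat | ZZero | ZOpp of zexpr | ZAdd of zexpr & zexpr.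

Section Zexpr.
Variable V : zmodType.

Fixpoint zeval (s : seq V) (t : zexpr) : V :=
  match t with
  | ZVar i => s`_i
  | ZZero => 0
  | ZOpp t => - zeval s t
  | ZAdd t1 t2 => zeval s t1 + zeval s t2
  end.

Fixpoint zcoef (i : nat) (t : zexpr) : int :=
  match t with
  | ZVar j => (i == j)%:R
  | ZZero => 0
  | ZOpp t => - zcoef i t
  | ZAdd t1 t2 => zcoef i t1 + zcoef i t2
  end.

Lemma zevalE s t : zeval s t = \sum_(i < size s) s`_i *~ zcoef i t.
Proof.
elim: t => /= [j||t ->|t1 -> t2 ->].
- have [ltj|gej] := ltnP j (size s); last first.
    rewrite nth_default // big1 // => i _.
    by have [ij|] := eqVneq (i : nat) j; [rewrite -ij leqNgt ltn_ord in gej|].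
  rewrite (bigD1 (Ordinal ltj)) //= eqxx mulr1z big1 ?addr0 // => i.
  by rewrite -val_eqE /= => /negPf->.
- by rewrite big1.
- by rewrite -sumrN; apply: eq_bigr => i _; rewrite mulrNz.
- by rewrite -big_split; apply: eq_bigr => i _; rewrite mulrzDr.
Qed.

Lemma zeval_eq s t1 t2 :
  all (fun i => zcoef i t1 == zcoef i t2) (iota 0 (size s)) ->
  zeval s t1 = zeval s t2.
Proof.
move/allP => h; rewrite !zevalE; apply: eq_bigr => i _; congr (_ *~ _).
by apply/eqP; apply: h; rewrite mem_iota ltn_ord.
Qed.
End Zexpr.

(** To deduce an equation from another one, it is enough to compare differences,
    which is a task for [zmodule] below. *)
Lemma eq_of_diff_eq (V : zmodType) (x y z t : V) :
  x = y -> z - t = x - y -> z = t.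
Proof. by move=> ->; rewrite subrr => /subr0_eq. Qed.

(* Atoms are compared up to conversion: vectors inside a bracket may be built
   with different presentations of the same addition. *)
Ltac zindex x s :=
  match s with
  | ?y :: _ => let e := constr:(erefl x : x = y) in constr:(0%N)
  | _ :: ?s' => let n := zindex x s' in constr:(S n)
  end.
Ltac zatoms t s :=
  lazymatch t with
  | ?x + ?y => let s1 := zatoms x s in zatoms y s1
  | - ?x => zatoms x s
  | 0 => s
  | ?x => match s with
          | _ => let n := zindex x s in s
          | _ => constr:(x :: s)
          end
  end.
Ltac zreify t s :=
  lazymatch t with
  | ?x + ?y => let a := zreify x s in let b := zreify y s in constr:(ZAdd a b)
  | - ?x => let a := zreify x s in constr:(ZOpp a)
  | 0 => constr:(ZZero)
  | ?x => let n := zindex x s in constr:(ZVar n)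
  end.
(** Proves an equation between sums and opposites in an abelian group by
    comparing the coefficients of the atoms. *)
Ltac zmodule :=
  lazymatch goal with |- @eq ?T ?x ?y =>
    let s := zatoms x (@nil T) in let s := zatoms y s in
    let a := zreify x s in let b := zreify y s in
    apply: (@zeval_eq _ s a b); vm_compute; reflexivity
  end.

(* This keeps the conversion tests between atoms from unfolding brackets. *)
Opaque br.

(** * Relations between two hyperbolic pairs *)
Section TwoPairs.
Variable g : nat.
Implicit Types a b : HZ g.

Definition two_pairs a1 b1 a2 b2 : Prop :=
  [/\ omega a1 b1 = 1, omega a2 b2 = 1, omega a1 a2 = 0, omega a1 b2 = 0
    & omega b1 a2 = 0 /\ omega b1 b2 = 0].

Lemma two_pairsE a1 b1 a2 b2 : two_pairs a1 b1 a2 b2 ->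
  ((omega a1 b1 = 1) * (omega b1 a1 = -1) * (omega a2 b2 = 1) *
   (omega b2 a2 = -1) * (omega a1 a2 = 0) * (omega a2 a1 = 0) *
   (omega a1 b2 = 0) * (omega b2 a1 = 0) * (omega b1 a2 = 0) *
   (omega a2 b1 = 0) * (omega b1 b2 = 0) * (omega b2 b1 = 0))%type.
Proof.
case=> h1 h2 h3 h4 [h5 h6]; do !split=> //;
  by rewrite omegaC ?h1 ?h2 ?h3 ?h4 ?h5 ?h6 ?oppr0.
Qed.

End TwoPairs.

Ltac omega_pairs T := rewrite ?omegaE ?T; done.
Ltac unimod_pairs T a1 b1 a2 b2 :=
  first [ exists b1; omega_pairs T | exists b2; omega_pairs T
        | exists (- a1); omega_pairs T | exists (- a2); omega_pairs T
        | exists (- b1); omega_pairs T | exists (- b2); omega_pairs T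
        | exists a1; omega_pairs T | exists a2; omega_pairs T ].
(** [pairs H] proves orthogonality, unimodularity and hyperbolicity goals about
    small combinations of the four vectors of H : two_pairs a1 b1 a2 b2.  For
    unimodularity, the witness is searched among these vectors up to sign. *)
Ltac pairs H :=
  match type of H with two_pairs ?a1 ?b1 ?a2 ?b2 =>
    let T := fresh in have T := two_pairsE H;
    match goal with
    | |- unimod _ => unimod_pairs T a1 b1 a2 b2
    | |- two_pairs _ _ _ _ => by do !split; omega_pairs T
    | _ => omega_pairs T
    end
  end.

Section Relations.
Variables (g : nat) (hg : (2 <= g)%N).
Implicit Types (a b u v w x y : HZ g).

(** The bracket of a1 + a2 and b1 - b2 does not expand, since a1 is not
    orthogonal to b1; the two other terms cancel the part of the expansion that
    makes sense. What remains has to be B(a1, b1) - B(a2, b2) for a form B that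
    realizes the bracket. *)
Definition mixed a1 b1 a2 b2 : Zs g :=
  br (a1 + a2) (b1 - b2) + br a1 b2 - br a2 b1.

Definition polar x y : Zs g := br (x + y) (x + y) - br x x - br y y.

Lemma polarC x y : polar x y = polar y x.
Proof. by rewrite /polar [y + x]addrC addrAC. Qed.

Lemma mixed_addb a1 b1 a2 b2 : two_pairs a1 b1 a2 b2 ->
  mixed a1 b1 a2 (b2 + a2) = mixed a1 b1 a2 b2 - br a2 a2.
Proof.
move=> H; rewrite /mixed opprD [b1 + _]addrA.
rewrite [br (a1 + a2) (_ - a2)]brDr; try pairs H.
rewrite [br a1 (b2 + a2)]brDr ?brNr; try pairs H.
rewrite [br (a1 + a2) a2]brDl; try pairs H.
zmodule.
Qed.

Lemma mixed_adda a1 b1 a2 b2 : two_pairs a1 b1 a2 b2 ->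
  mixed a1 b1 (a2 + b2) b2 = mixed a1 b1 a2 b2 - br b2 b2.
Proof.
move=> H; rewrite /mixed [a1 + _]addrA.
rewrite [br (_ + b2) (b1 - b2)]brDl; try pairs H.
rewrite [br (a2 + b2) b1]brDl; try pairs H.
rewrite [br b2 (b1 - b2)]brDr ?brNr; try pairs H.
zmodule.
Qed.

Lemma brNN x : unimod x -> br (- x) (- x) = br x x.
Proof.
move=> xu; have nxu := unimodN xu.
by rewrite brNr ?brNl ?opprK // ?omegaNl omegavv ?oppr0.
Qed.

(** The turn is the product of the three shears (a, b) -> (a + b, b),
    (a + b, b) -> (a + b, - a) and (a + b, - a) -> (b, - a), whose effects on
    the mixed bracket are - q(b), q(a + b) and - q(a). *)
Lemma mixed_turn a1 b1 a2 b2 : two_pairs a1 b1 a2 b2 ->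
  mixed a1 b1 b2 (- a2) = mixed a1 b1 a2 b2 + polar a2 b2.
Proof.
move=> H; have H1 : two_pairs a1 b1 (a2 + b2) (- a2) by pairs H.
have E0 := mixed_adda H; have E1 := mixed_addb H1; have := mixed_adda H1.
rewrite [a2 + b2 - a2]addrC addKr in E1 *.
rewrite brNN => [->|]; last by pairs H.
rewrite E0 in E1; apply: (eq_of_diff_eq (esym E1)); rewrite /polar.
zmodule.
Qed.

Lemma two_pairs_turn a1 b1 a2 b2 :
  two_pairs a1 b1 a2 b2 -> two_pairs a1 b1 b2 (- a2).
Proof. by move=> H; pairs H. Qed.

Lemma polarNN x y : unimod x -> unimod y -> unimod (x + y) ->
  polar (- x) (- y) = polar x y.
Proof. by move=> *; rewrite /polar -opprD !brNN. Qed.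

Lemma addxx_eq0 (V : lmodType rat) (x : V) : x + x = 0 -> x = 0.
Proof.
move=> xx; rewrite -[x]scale1r -[1](@mulVf _ 2) // -scalerA.
by rewrite scaler_nat [x *+ 2]mulr2n xx scaler0.
Qed.

(** Four quarter turns of the second pair bring the mixed bracket back to
    itself, so twice the corrections collected by two turns vanishes. This is
    the parallelogram law q(x + y) + q(y - x) = 2 q(x) + 2 q(y). *)
Lemma polar_turn a1 b1 a2 b2 : two_pairs a1 b1 a2 b2 ->
  polar a2 b2 + polar b2 (- a2) = 0.
Proof.
move=> H; have H1 := two_pairs_turn H; have H2 := two_pairs_turn H1.
have H3 := two_pairs_turn H2; apply: addxx_eq0.
have := mixed_turn H3; rewrite (mixed_turn H2) (mixed_turn H1) (mixed_turn H).
rewrite !opprK [polar (- a2) _]polarNN; try pairs H.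
have -> : polar (- b2) a2 = polar b2 (- a2).
  by rewrite -[a2 in LHS]opprK polarNN; try pairs H.
by move/esym => E; apply: (eq_of_diff_eq E); zmodule.
Qed.

Lemma mixed_opp a1 b1 a2 b2 : two_pairs a1 b1 a2 b2 ->
  mixed a1 b1 (- a2) (- b2) = mixed a1 b1 a2 b2.
Proof.
move=> H; have H1 := two_pairs_turn H.
by rewrite (mixed_turn H1) (mixed_turn H) -addrA (polar_turn H) addr0.
Qed.

Lemma br_add_sub x y : unimod x -> unimod y -> unimod (x + y) ->
  unimod (x - y) -> omega x y = 0 -> br (x + y) (x - y) = br x x - br y y.
Proof.
move=> xu yu xyu xyu' xy; have yx : omega y x = 0 by rewrite omegaC xy oppr0.
have nyu := unimodN yu.
rewrite brDl ?brDr ?brNr // ?omegaE ?xy ?yx ?oppr0 // [br y x]brC.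
zmodule.
Qed.

(** With u = a1 + b1 and w = a2 + b2, the bracket of u + w and u - w is q(u) -
    q(w); regrouped as (a1 + a2) + (b1 + b2) and (a1 - a2) + (b1 - b2), where
    each summand of one is orthogonal to each summand of the other, it yields
    the mixed brackets of (a2, b2) and of (- a2, - b2), which are equal by
    [mixed_opp]. *)
Lemma mixed_polar a1 b1 a2 b2 : two_pairs a1 b1 a2 b2 ->
  mixed a1 b1 a2 b2 + mixed a1 b1 a2 b2 = polar a1 b1 - polar a2 b2.
Proof.
move=> H; rewrite -{2}(mixed_opp H).
have E : br (a1 + b1 + (a2 + b2)) (a1 + b1 - (a2 + b2)) =
         br (a1 + a2 + (b1 + b2)) (a1 - a2 + (b1 - b2)).
  by rewrite opprD addrACA [in X in br _ X = _]addrACA.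
move: E; rewrite br_add_sub; try pairs H.
rewrite [br (a1 + a2 + _) _]brDl; try pairs H.
do 2 (rewrite [br _ (a1 - a2 + _)]brDr; try pairs H).
rewrite !br_add_sub; try pairs H.
rewrite [br (b1 + b2) (a1 - a2)]brC => E; apply: (eq_of_diff_eq (esym E)).
rewrite /mixed /polar !opprK brNr ?brNl; try pairs H.
zmodule.
Qed.

End Relations.

(** * Bilinear forms realizing the bracket *)
Section Realization.
Variables (g : nat) (hg : (2 <= g)%N).
Variable B : HZ g -> HZ g -> Zs g.
Hypothesis BC : forall x y, B x y = B y x.
Hypothesis BB : forall x, zmod_morphism (B x).
Implicit Types (a b : 'I_g -> HZ g) (u v w x y : HZ g).

Let Badd x : {additive HZ g -> Zs g} :=
  HB.pack (B x) (GRing.isZmodMorphism.Build _ _ (B x) (@BB x)).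

Let BDr x y z : B x (y + z) = B x y + B x z.
Proof. exact: (raddfD (Badd x)). Qed.
Let BNr x y : B x (- y) = - B x y.
Proof. exact: (raddfN (Badd x)). Qed.
Let BDl x y z : B (y + z) x = B y x + B z x.
Proof. by rewrite BC BDr ![B x _]BC. Qed.
Let BNl x y : B (- y) x = - B y x.
Proof. by rewrite BC BNr [B x _]BC. Qed.
Let BE := (BDl, BDr, BNl, BNr).

Definition realized v : Prop :=
  forall w, unimod w -> omega v w = 0 -> br v w = B v w.
Definition sqr_realized v : Prop := br v v = B v v.

(** The last condition pins down B (a i) (b i), which is no bracket because a i
    and b i are not orthogonal. *)
Definition basis_realized a b : Prop :=
  forall i, [/\ realized (a i), realized (b i) & sqr_realized (a i + b i)].

Lemma realized_swap v w :
  realized w -> unimod v -> omega v w = 0 -> br v w = B v w.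
Proof.
by move=> gw vu vw; rewrite brC BC gw // omegaC vw oppr0.
Qed.

Lemma realized_sqr v : unimod v -> realized v -> sqr_realized v.
Proof. by move=> vu; apply; rewrite ?omegavv. Qed.

Lemma realized_opp v : unimod v -> realized v -> realized (- v).
Proof.
move=> vu gv w wu; rewrite omegaNl => /eqP; rewrite oppr_eq0 => /eqP vw.
by rewrite brNl // gv // BNl.
Qed.

(** Both sides are additive on the complement of a i, so they only have to be
    compared on its basis. *)
Lemma realized_sympl a b i : sympl a b ->
  (forall k, br (a i) (a k) = B (a i) (a k)) ->
  (forall k, k != i -> br (a i) (b k) = B (a i) (b k)) -> realized (a i).
Proof.
move=> ab ga gb w wu aw; have ui := sympl_unimod_a i ab.
have [F brF] := br_additive hg ui; have [aa bb e1 e2] := symplE ab.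
rewrite brF //; apply: (eq_on_perp (G := Badd (a i)) ab aw) => k.
  by rewrite -brF ?aa //; apply: sympl_unimod_a ab.
move=> ki; rewrite -brF ?gb //; first exact: sympl_unimod_b ab.
by rewrite e1 eq_sym (negPf ki).
Qed.

Lemma sympl_two_pairs a b i j : sympl a b -> i != j ->
  two_pairs (a i) (b i) (a j) (b j).
Proof.
move=> ab ij; have [aa bb e1 e2] := symplE ab.
by do !split; rewrite ?aa ?bb ?e1 ?e2 ?eqxx ?[j == i]eq_sym ?(negPf ij) ?oppr0.
Qed.

Lemma polar_realized x y :
  sqr_realized x -> sqr_realized y -> sqr_realized (x + y) ->
  polar x y = B x y + B x y.
Proof.
move=> qx qy qxy; rewrite /polar qxy qx qy !BE [B y x]BC.
zmodule.
Qed.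

(** B satisfies the parallelogram law, and so does q by [polar_turn]. *)
Lemma sqr_realized_parallelogram u v x y :
  two_pairs u v x y -> sqr_realized x -> sqr_realized y ->
  sqr_realized (x + y) <-> sqr_realized (y - x).
Proof.
move=> H qx qy; have := polar_turn hg H; rewrite /polar /sqr_realized.
rewrite brNN //; last by pairs H.
rewrite qx qy !BE [B y x]BC !opprK => E.
by split=> q; apply: (eq_of_diff_eq E); rewrite q; zmodule.
Qed.

Lemma sqr_realizedD x y :
  unimod x -> unimod y -> unimod (x + y) -> omega x y = 0 ->
  sqr_realized x -> realized y -> sqr_realized (x + y).
Proof.
move=> xu yu xyu xy qx gy; have yx : omega y x = 0 by rewrite omegaC xy oppr0.
rewrite /sqr_realized brDr ?omegaE ?xy ?yx //.
rewrite (realized_swap gy) ?omegaE ?xy ?yx //.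
by rewrite brDl ?omegavv // qx gy // !BE [B y x]BC.
Qed.

(** Here g >= 2 provides the auxiliary pair for the relations above. *)
Lemma sympl_neighbour a b i : sympl a b ->
  exists j, j != i /\ two_pairs (a j) (b j) (a i) (b i).
Proof.
move=> ab; have [j ji] := exists_other_pair hg i.
by exists j; split=> //; apply: sympl_two_pairs.
Qed.

Lemma sqr_realized_sub a b i :
  sympl a b -> basis_realized a b -> sqr_realized (b i - a i).
Proof.
move=> ab cab; have [j [_ H]] := sympl_neighbour i ab.
have [ga gb qab] := cab i.
have ua := sympl_unimod_a i ab; have ub := sympl_unimod_b i ab.
by apply/(sqr_realized_parallelogram H); rewrite //; apply: realized_sqr.
Qed.

Lemma basis_realized_turn a b i : sympl a b -> basis_realized a b ->
  basis_realized (upd a i (b i)) (upd b i (- a i)).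
Proof.
move=> ab cab k; have [ga gb qab] := cab k.
rewrite /upd; case: eqP => // E; rewrite -E; split=> //.
  by apply: realized_opp => //; apply: sympl_unimod_a ab.
exact: sqr_realized_sub.
Qed.

(** Every basis vector other than the new one is realized, so only the square of
    the new b i, and that of a i plus it, need an argument: a i + (b i - a i) is
    b i, and a i + (b i + a i) is handled by the parallelogram law for the pair
    (a i, b i + a i). *)
Lemma basis_realized_shear a b i (m : int) : m = 1 \/ m = -1 ->
  sympl a b -> basis_realized a b ->
  basis_realized a (upd b i (b i + a i *~ m)).
Proof.
move=> m1 ab cab; have ab' := sympl_shear i m ab.
have ab2 := sympl_turn i ab'; set v := b i + a i *~ m.
have [ga gb qab] := cab i; have vu : unimod v.
  by have := sympl_unimod_b i ab'; rewrite updE.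
have [j [ji H']] := sympl_neighbour i ab'.
have ua := sympl_unimod_a i ab; have ub := sympl_unimod_b i ab.
have qa := realized_sqr ua ga; have qb := realized_sqr ub gb.
have qv : sqr_realized v.
  case: m1 => m1; rewrite /v m1 ?mulr1z ?mulrN1z; first by rewrite addrC.
  exact: sqr_realized_sub.
have gv : realized v.
  have := @realized_sympl _ _ i ab2; rewrite !updE.
  have [aa bb e1 e2] := symplE ab2.
  apply=> k.
    have [->|ki] := eqVneq k i; first by rewrite updE.
    have := aa i k; rewrite !updE !(upd_neq _ _ ki) => o.
    by apply: realized_swap => //; have [] := cab k.
  move=> ki; have := e1 i k.
  rewrite !updE !(upd_neq _ _ ki) eq_sym (negPf ki) => o.
  by apply: realized_swap => //; have [] := cab k.
move=> k; have [gak gbk qabk] := cab k.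
rewrite /upd; case: eqP => // ->; split=> //.
case: m1 => m1; last by rewrite /v m1 mulrN1z addrC subrK.
move: H'; rewrite updE (upd_neq _ _ ji) => H'.
apply/(sqr_realized_parallelogram H') => //.
by rewrite /v m1 mulr1z addrK; apply: realized_sqr.
Qed.

(** [mixed_polar] computes twice this bracket in terms of values that B already
    realizes. *)
Lemma br_mixed a b i j : sympl a b -> basis_realized a b -> i != j ->
  br (a i + a j) (b i - b j) = B (a i + a j) (b i - b j).
Proof.
move=> ab cab ij; have H := sympl_two_pairs ab ij.
have [gai gbi qi] := cab i; have [gaj gbj qj] := cab j.
have qai : sqr_realized (a i) by apply: realized_sqr => //; pairs H.
have qbi : sqr_realized (b i) by apply: realized_sqr => //; pairs H.
have qaj : sqr_realized (a j) by apply: realized_sqr => //; pairs H.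
have qbj : sqr_realized (b j) by apply: realized_sqr => //; pairs H.
have := mixed_polar hg H; rewrite /mixed !polar_realized //.
rewrite gai; try pairs H.
rewrite gaj; try pairs H.
move=> E; apply: subr0_eq; apply: (@addxx_eq0 (Zs g)).
by rewrite !BE; apply: (eq_of_diff_eq E); zmodule.
Qed.

(** The basis vectors orthogonal to both a i and a j, or to both b i and b j,
    pose no problem. What is left is the bracket of the two new vectors, which
    is [br_mixed], and the squares, where the added vector is orthogonal to the
    rest of the sum. *)
Lemma basis_realized_mix a b i j : i != j -> sympl a b -> basis_realized a b ->
  basis_realized (upd a j (a j + a i)) (upd b i (b i - b j)).
Proof.
move=> ij ab cab; have ji : j != i by rewrite eq_sym.
have H := sympl_two_pairs ab ij; have ab' := sympl_mix ij ab.
have ab2 := sympl_turn i ab'; have [aa bb e1 e2] := symplE ab.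
set v := a j + a i; set w := b i - b j.
have [gai gbi qi] := cab i; have [gaj gbj qj] := cab j.
have Bv : br v w = B v w by rewrite /v addrC; apply: br_mixed.
have vu : unimod v by pairs H.
have wu : unimod w by pairs H.
have gv : realized v.
  have := @realized_sympl _ _ j ab'; rewrite updE; apply=> k.
    have [->|kj] := eqVneq k j.
      rewrite updE -/(sqr_realized _); apply: sqr_realizedD => //; try pairs H.
      by apply: realized_sqr => //; pairs H.
    rewrite (upd_neq _ _ kj); have [gak _ _] := cab k.
    by apply: realized_swap => //; rewrite /v omegaDl !aa.
  move=> kj; have [->|ki] := eqVneq k i; first by rewrite updE.
  rewrite (upd_neq _ _ ki); have [_ gbk _] := cab k.
  apply: realized_swap => //.
  by rewrite /v omegaDl !e1 eq_sym (negPf kj) eq_sym (negPf ki).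
have gw : realized w.
  have := @realized_sympl _ _ i ab2; rewrite !updE; apply=> k.
    have [->|ki] := eqVneq k i.
      rewrite updE -/(sqr_realized _); apply: sqr_realizedD => //; try pairs H.
        by apply: realized_sqr => //; pairs H.
      by apply: realized_opp => //; pairs H.
    rewrite (upd_neq _ _ ki); have [->|kj] := eqVneq k j.
      by rewrite updE brC BC.
    rewrite (upd_neq _ _ kj); have [gak _ _] := cab k.
    apply: realized_swap => //.
    by rewrite /w omegaDl omegaNl !e2 (negPf ki) (negPf kj) !oppr0.
  move=> ki; rewrite !(upd_neq _ _ ki); have [_ gbk _] := cab k.
  by apply: realized_swap => //; rewrite /w omegaDl omegaNl !bb oppr0.
move=> k; have [gak gbk qk] := cab k.
have [->|kj] := eqVneq k j.
  rewrite updE (upd_neq _ _ ji); split=> //; rewrite /v addrAC.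
  apply: sqr_realizedD => //; pairs H.
rewrite (upd_neq _ _ kj); have [->|ki] := eqVneq k i; last first.
  by rewrite (upd_neq _ _ ki).
rewrite updE; split=> //; rewrite /w addrA.
by apply: sqr_realizedD => //; try pairs H; apply: realized_opp => //; pairs H.
Qed.

Lemma realized_unimod a b v :
  sympl a b -> basis_realized a b -> unimod v -> realized v.
Proof.
move=> ab cab vu.
have [a' [b' [i [_ cab' ->]]]] :=
  sympl_reduce basis_realized_turn basis_realized_shear basis_realized_mix
    ab cab vu.
by have [] := cab' i.
Qed.

End Realization.

(** * The inverse of the linearization map *)
Lemma presented_ext (K : choiceType) (rel : {malg rat[K]} -> Prop)
    (V : lmodType rat) (F G : {linear presented rel -> V}) :
  (forall k, F (psym rel k) = G (psym rel k)) -> F =1 G.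
Proof.
have piE x : \pi_(presented rel) x = \sum_(k <- msupp x) x@_k *: psym rel k.
  rewrite {1}(monalgE x) raddf_sum; apply: eq_bigr => k _.
  have -> : << x@_k *g k >> = x@_k *: fgen k.
    rewrite fgen.unlock; apply/malgP => j.
    by rewrite mcoeffZ !mcoeffU mulr_natr.
  exact: esym (pscale_pi _ _ _).
move=> FG q; rewrite -[q]reprK piE !linear_sum; apply: eq_bigr => k _.
by rewrite !linearZ /= FG.
Qed.

Lemma sprod0l (V : lmodType rat) (y : V) : sprod 0 y = 0.
Proof. by apply: (addrI (sprod 0 y)); rewrite -sprodDl !addr0. Qed.

Lemma sprodZl (V : lmodType rat) c (x y : V) :
  sprod (c *: x) y = c *: sprod x y.
Proof.
apply/eqP; rewrite -subr_eq0; apply/eqP.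
rewrite -(psym_rel (Sym2_scale c x y)) raddfB; congr (_ - _).
exact: pscale_pi.
Qed.

Lemma sprodZr (V : lmodType rat) c (x y : V) :
  sprod x (c *: y) = c *: sprod x y.
Proof. by rewrite sprodC sprodZl sprodC. Qed.

Lemma sprod_suml (V : lmodType rat) (I : Type) (r : seq I) (F : I -> V) y :
  sprod (\sum_(i <- r) F i) y = \sum_(i <- r) sprod (F i) y.
Proof.
apply: (big_morph (fun x => sprod x y) (fun x x' => sprodDl x x' y)).
exact: sprod0l.
Qed.

Lemma sprod_sumr (V : lmodType rat) (I : Type) (r : seq I) (F : I -> V) x :
  sprod x (\sum_(i <- r) F i) = \sum_(i <- r) sprod x (F i).
Proof. by rewrite sprodC sprod_suml; apply: eq_bigr => i _; rewrite sprodC. Qed.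

Section Inverse.
Variables (g : nat) (hg : (2 <= g)%N).

Definition stdv (k : 'I_(g + g)) : HZ g := delta_mx 0 k.

(** The polarization of q replaces the bracket between vectors that are not
    orthogonal. *)
Definition gram (k l : 'I_(g + g)) : Zs g :=
  if omega (stdv k) (stdv l) == 0 then br (stdv k) (stdv l)
  else 2^-1 *: polar (stdv k) (stdv l).

Lemma gramC k l : gram k l = gram l k.
Proof.
by rewrite /gram [omega (stdv l) _]omegaC oppr_eq0 brC polarC.
Qed.

Definition gram_form (x y : H g) : Zs g :=
  let c (z : 'rV[rat]_(g + g)) k := z 0 k in
  \sum_k \sum_l (c x k * c y l) *: gram k l.

Lemma gram_formDl x x' y :
  gram_form (x + x') y = gram_form x y + gram_form x' y.
Proof.
rewrite /gram_form -big_split; apply: eq_bigr => k _.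
rewrite -big_split; apply: eq_bigr => l _ /=.
by rewrite mxE mulrDl scalerDl.
Qed.

Lemma gram_formZl c x y : gram_form (c *: x) y = c *: gram_form x y.
Proof.
rewrite /gram_form scaler_sumr; apply: eq_bigr => k _.
rewrite scaler_sumr; apply: eq_bigr => l _ /=.
by rewrite mxE -mulrA scalerA.
Qed.

Lemma gram_formC x y : gram_form x y = gram_form y x.
Proof.
rewrite /gram_form [LHS]exchange_big /=.
apply: eq_bigr => k _.
apply: eq_bigr => l _.
rewrite (gramC l k).
by rewrite [_ * _]mulrC.
Qed.

Lemma gram_form_rel r :
  sym2_rel r -> linext (fun p : H g * H g => gram_form p.1 p.2) r = 0.
Proof.
case=> [x x' y|c x y|x y]; rewrite !linextB ?linearZ /= !linextU /=.
- by rewrite gram_formDl addrAC addrK subrr.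
- by rewrite gram_formZl scalerN subrr.
- by rewrite gram_formC subrr.
Qed.

Definition Phi_inv : {linear Sym2 (H g) -> Zs g} := plift gram_form_rel.

Lemma Phi_inv_sprod x y : Phi_inv (sprod x y) = gram_form x y.
Proof. exact: plift_psym. Qed.

Lemma Phi_br v w : unimod v -> unimod w -> omega v w = 0 ->
  Phi g (br v w) = sprod (toH v) (toH w).
Proof.
move=> /primitiveP pv /primitiveP pw vw.
by rewrite -(zs_sym_br pv pw vw) Phi_zs_sym.
Qed.

Lemma Phi_polar v w : unimod v -> unimod w -> unimod (v + w) ->
  Phi g (polar v w) = sprod (toH v) (toH w) + sprod (toH v) (toH w).
Proof.
move=> vu wu vwu; rewrite !raddfB /= !Phi_br ?omegavv //.
have -> : toH (v + w) = toH v + toH w :> H g by rewrite /toH map_mxD.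
rewrite sprodDl ![sprod _ (toH v + toH w)]sprodC !sprodDl.
rewrite [sprod (toH w) (toH v)]sprodC.
zmodule.
Qed.

Lemma unimod_add_stdv k l : omega (stdv k) (stdv l) != 0 ->
  unimod (stdv k + stdv l).
Proof.
move=> kl; have [aa bb e1 e2] := symplE (sympl_std g).
move: kl; rewrite -[k]splitK -[l]splitK.
case: (split k) => i; case: (split l) => j /=;
  rewrite -?[stdv (lshift g _)]/(stda _) -?[stdv (rshift g _)]/(stdb _);
  rewrite ?aa ?bb ?e1 ?e2 ?eqxx //.
  by exists (stdb i); rewrite omegaDl e1 bb eqxx.
by exists (stdb j); rewrite omegaDl e1 bb eqxx.
Qed.

Lemma stdv_unimod k : unimod (stdv k).
Proof.
rewrite -[k]splitK; case: (split k) => i.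
  exact: sympl_unimod_a (sympl_std g).
exact: sympl_unimod_b (sympl_std g).
Qed.

Lemma Phi_gram k l : Phi g (gram k l) = sprod (toH (stdv k)) (toH (stdv l)).
Proof.
have uk := stdv_unimod k; have ul := stdv_unimod l.
rewrite /gram; case: eqP => [kl|/eqP kl]; first by rewrite Phi_br.
rewrite linearZ /= Phi_polar //; last exact: unimod_add_stdv.
by rewrite -mulr2n -scaler_nat scalerA mulVf // scale1r.
Qed.

Lemma PhiK : cancel Phi_inv (Phi g).
Proof.
move=> s; pose F : {linear Sym2 (H g) -> Sym2 (H g)} := Phi g \o Phi_inv.
pose G : {linear Sym2 (H g) -> Sym2 (H g)} := idfun.
apply: (@presented_ext _ _ _ F G) => -[x y] /=.
rewrite -/(sprod x y) Phi_inv_sprod /gram_form linear_sum /=.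
under eq_bigr => k _.
  rewrite linear_sum; under eq_bigr => l _ do
    rewrite linearZ /= Phi_gram -scalerA -sprodZr -sprodZl.
  rewrite -sprod_sumr.
  over.
rewrite -sprod_suml.
have xE (z : H g) : \sum_i (z : 'rV[rat]_(g + g)) 0 i *: toH (stdv i) = z.
  rewrite [RHS](row_sum_delta (z : 'rV[rat]_(g + g))); apply: eq_bigr => i _.
  by rewrite /toH map_delta_mx.
by rewrite !xE.
Qed.

Definition lattice_form (v w : HZ g) : Zs g := gram_form (toH v) (toH w).

Lemma lattice_formC v w : lattice_form v w = lattice_form w v.
Proof. exact: gram_formC. Qed.

Lemma lattice_formB v : zmod_morphism (lattice_form v).
Proof.
move=> x y; rewrite /lattice_form.
have -> : toH (x - y) = toH x + (-1) *: toH y :> H g.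
  by rewrite scaleN1r /toH map_mxD map_mxN.
by rewrite ![gram_form (toH v) _]gram_formC gram_formDl gram_formZl scaleN1r.
Qed.

Lemma lattice_form_std k l : lattice_form (stdv k) (stdv l) = gram k l.
Proof.
rewrite /lattice_form /gram_form /toH !map_delta_mx.
rewrite (bigD1 k) //= [X in _ + X]big1 => [|k' kk]; last first.
  apply: big1 => l' _.
  by rewrite [delta_mx 0 k 0 k']mxE (negPf kk) andbF mul0r scale0r.
rewrite addr0 (bigD1 l) //= [X in _ + X]big1 => [|l' ll]; last first.
  by rewrite [delta_mx 0 l 0 l']mxE (negPf ll) andbF mulr0 scale0r.
by rewrite addr0 !mxE !eqxx mulr1 scale1r.
Qed.

Lemma lattice_form_br k l : omega (stdv k) (stdv l) = 0 ->
  br (stdv k) (stdv l) = lattice_form (stdv k) (stdv l).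
Proof. by move=> kl; rewrite lattice_form_std /gram kl eqxx. Qed.

(** Basis vectors are realized by the choice of [gram]; [realized_sympl] extends
    this to their orthogonal complements. *)
Lemma basis_realized_std : basis_realized lattice_form (@stda g) (@stdb g).
Proof.
have std := sympl_std g; have [aa bb e1 e2] := symplE std => i.
have LF v w k l : v = stdv k -> w = stdv l -> omega v w = 0 ->
  br v w = lattice_form v w by move=> -> ->; apply: lattice_form_br.
have La k l := LF (stda k) (stda l) _ _ erefl erefl.
have Lb k l := LF (stdb k) (stdb l) _ _ erefl erefl.
have Lab k l := LF (stda k) (stdb l) _ _ erefl erefl.
have Lba k l := LF (stdb k) (stda l) _ _ erefl erefl.
split.
- apply: (realized_sympl hg lattice_formB std) => [k|k ki]; first exact: La.
  by apply: Lab; rewrite e1 eq_sym (negPf ki).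
- have := realized_sympl hg lattice_formB (sympl_turn i std) (i := i).
  rewrite updE; apply=> [k|k ki].
    have [->|ki] := eqVneq k i; rewrite ?updE ?(upd_neq _ _ ki).
      exact: Lb.
    by apply: Lba; rewrite e2 (negPf ki) oppr0.
  by rewrite (upd_neq _ _ ki); apply: Lb.
have LD v w w' : lattice_form v (w + w') = lattice_form v w + lattice_form v w'.
  rewrite /lattice_form -!(gram_formC _ (toH v)) -gram_formDl.
  by rewrite /toH map_mxD.
rewrite /sqr_realized LD ![lattice_form (_ + _) _]lattice_formC !LD.
rewrite [lattice_form (stdb i) (stda i)]lattice_formC.
rewrite -La ?omegavv // -Lb ?omegavv //.
have E : polar (stda i) (stdb i) =
    lattice_form (stda i) (stdb i) + lattice_form (stda i) (stdb i).
  rewrite [lattice_form _ _]lattice_form_std /gram; case: eqP => [o|_].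
    by have := e1 i i; rewrite eqxx [omega _ _]o.
  by rewrite -scalerDl -[X in X + X]div1r -splitr scale1r.
by apply: (eq_of_diff_eq E); rewrite /polar; zmodule.
Qed.

Lemma Phi_invK : cancel (Phi g) Phi_inv.
Proof.
move=> s; pose F : {linear Zs g -> Zs g} := Phi_inv \o Phi g.
pose G : {linear Zs g -> Zs g} := idfun.
apply: (@presented_ext _ _ _ F G) => k /=.
rewrite [Phi g _]plift_psym Phi_inv_sprod psym_br.
case: k => -[v w] /= h; have /asboolP[/= pv pw vw] := h.
apply/esym; apply: (realized_unimod hg lattice_formC lattice_formB) (vw).
- exact: sympl_std.
- exact: basis_realized_std.
- exact/primitiveP.
- exact/primitiveP.
Qed.

End Inverse.

Theorem theorem5 (g : nat) (hg : (2 <= g)%N) :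
  (forall (v1 v2 : HZ g) (p1 : primitive v1) (p2 : primitive v2)
          (o12 : omega v1 v2 = 0),
      Phi g (zs_sym p1 p2 o12) = sprod (toH v1) (toH v2)) /\
  bijective (Phi g).
Proof.
split; first exact: Phi_zs_sym.
by exists (@Phi_inv g); [apply: Phi_invK | apply: PhiK].
Qed.
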